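(* Let $s\in(0,1]$, let $I\subset(0,\infty)$ be an interval, let $f:I\to\mathbb{R}$ be differentiable on $I^\circ$, let $a,b\in I$ with $a<b$, and suppose $f'\in L[a,b]$. Let $q>1$ and $\frac1p+\frac1q=1$. If $|f'|^q$ is harmonically $s$-convex on $[a,b]$, then for all $x\in[a,b]$, $$\left|f(x)-\frac{ab}{b-a}\int_a^b\frac{f(u)}{u^2}\,du\right|\le\frac{ab}{b-a}\left\{\big(\lambda_1(a,x,0,p,p)\big)^{\frac1p}(x-a)^2\left(\frac{|f'(x)|^q+|f'(a)|^q}{s+1}\right)^{\frac1q}+\big(\lambda_3(b,x,0,p,p)\big)^{\frac1p}(b-x)^2\left(\frac{|f'(x)|^q+|f'(b)|^q}{s+1}\right)^{\frac1q}\right\}.$$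
   Context: For fixed $s\in(0,1]$ and a real interval $J\subset(0,\infty)$, a function $g:J\to\mathbb{R}$ is harmonically $s$-convex if $g\left(\frac{xy}{tx+(1-t)y}\right)\le t^s g(y)+(1-t)^s g(x)$ for all $x,y\in J$ and $t\in[0,1]$. $I^\circ$ is the interior of $I$; $L[a,b]$ denotes the Lebesgue integrable functions on $[a,b]$. Since $f'$ is used on all of $[a,b]$, $f$ is understood to be differentiable at every point of $[a,b]$ (one-sided at a point of $[a,b]$ that is an endpoint of $I$). The functions $\lambda_1$ (for $0<a\le x$) and $\lambda_3$ (for $0<x\le b$) are defined, for a real parameter $\sigma\ge0$ in the third slot, by $$\lambda_1(a,x,\sigma,\vartheta,\rho)=\frac{\beta(\rho+\sigma+1,1)}{x^{2\vartheta}}\,{}_2F_1\left(2\vartheta,\rho+\sigma+1;\rho+\sigma+2;1-\frac ax\right),$$ $$\lambda_3(b,x,\sigma,\vartheta,\rho)=\frac{\beta(1,\rho+\sigma+1)}{b^{2\vartheta}}\,{}_2F_1\left(2\vartheta,1;\rho+\sigma+2;1-\frac xb\right).$$ Here $\beta(u,v)=\int_0^1t^{u-1}(1-t)^{v-1}\,dt$ for $u,v>0$ is the Euler Beta function, and ${}_2F_1(\alpha,\gamma;c;z)=\frac{1}{\beta(\gamma,c-\gamma)}\int_0^1t^{\gamma-1}(1-t)^{c-\gamma-1}(1-zt)^{-\alpha}\,dt$ for $c>\gamma>0$, $|z|<1$, is the hypergeometric function. *)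

(* Defs.v *)
From mathcomp Require Export all_boot all_order all_algebra.
From mathcomp Require Export all_classical all_reals all_analysis.
Export Order.TTheory GRing.Theory Num.Theory.
Export numFieldNormedType.Exports.

Set Implicit Arguments.
Unset Strict Implicit.
Unset Printing Implicit Defensive.

Local Open Scope classical_set_scope.
Local Open Scope ring_scope.

Section definitions.
Context {R : realType}.
Implicit Types (D J : set R) (f g : R -> R).

Definition slope f (x y : R) : R := (f y - f x) / (y - x).

(* A function D -> R is represented by a total function f : R -> R of which
   only the values on D matter.  The limit below is taken along the points of
   D other than x, so for an interval D it is the usual derivative at an
   interior point of D and a one-sided derivative at an endpoint of D. *)
Definition derivable_within D f (x : R) : Prop :=
  cvg (slope f x y @[y --> within D x^']).

Definition derive_within D f (x : R) : R :=
  lim (slope f x y @[y --> within D x^']).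

Definition harmonically_convex (s : R) J g : Prop :=
  forall x y t, J x -> J y -> 0 <= t <= 1 ->
    g (x * y / (t * x + (1 - t) * y)) <= t `^ s * g y + (1 - t) `^ s * g x.

(* The library's beta_fun only takes natural-number parameters.  At the
   endpoints t = 0 and t = 1, where an integrand with a negative exponent is
   undefined, powR returns 0; a two-point set does not affect the integral. *)
Definition euler_beta (u v : R) : R :=
  \int[@lebesgue_measure R]_(t in `[0, 1])
    (t `^ (u - 1) * (1 - t) `^ (v - 1)).

(* Meaningful for 0 < gamma < c and |z| < 1. *)
Definition hypergeom21 (alpha gamma c z : R) : R :=
  (euler_beta gamma (c - gamma))^-1 *
  \int[@lebesgue_measure R]_(t in `[0, 1])
    (t `^ (gamma - 1) * (1 - t) `^ (c - gamma - 1) *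
     (1 - z * t) `^ (- alpha)).

Definition lambda1 (a x sigma theta rho : R) : R :=
  euler_beta (rho + sigma + 1) 1 / x `^ (2 * theta) *
  hypergeom21 (2 * theta) (rho + sigma + 1) (rho + sigma + 2) (1 - a / x).

Definition lambda3 (b x sigma theta rho : R) : R :=
  euler_beta 1 (rho + sigma + 1) / b `^ (2 * theta) *
  hypergeom21 (2 * theta) 1 (rho + sigma + 2) (1 - x / b).

End definitions.

(* Main.v *)
Require Import Defs.
From mathcomp Require Import ring lra.

Set Implicit Arguments.
Unset Strict Implicit.
Unset Printing Implicit Defensive.

Local Open Scope classical_set_scope.
Local Open Scope ring_scope.

(* Let c be a or b, and parametrize the segment from c to x by
   u(t) = c x / (t c + (1 - t) x), along which 1/u is affine in t.  With F an
   antiderivative of f(u)/u^2, the function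
     P(t) = (1/c - 1/u(t)) f(u(t)) - F(u(t))
   satisfies P'(t) = (x - c)^2 t / (t c + (1 - t) x)^2 f'(u(t)).  Harmonic
   s-convexity bounds |f'(u(t))| by the continuous function
     M(t) = (t^s |f'(x)|^q + (1 - t)^s |f'(c)|^q)^(1/q),
   so the mean value theorem bounds |P(1) - P(0)| by the integral of a
   continuous function, and f' itself never has to be integrated.  Hoelder's
   inequality separates the kernel, whose p-th power integrates to lambda_1 or
   lambda_3, from M.  Subtracting the case c = b from the case c = a gives
   (1/a - 1/b) f(x) minus the integral of f(u)/u^2 over [a, b]. *)

(** * Continuity relative to a set, and real powers on the half-line *)

Section within_continuity.
Context {R : realType}.
Implicit Types (A B : set R) (f g : R -> R).

(** As [f] maps [A] into [B], it pushes the filter of neighborhoods within [A] to the one within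
    [B], so continuity of [g] relative to [B] suffices. *)
Lemma within_continuous_comp_in A B f g :
  {homo f : x / A x >-> B x} -> {within A, continuous f} ->
  {within B, continuous g} -> {within A, continuous (g \o f)}.
Proof.
move=> AB /subspace_continuousP cf /subspace_continuousP cg.
apply/subspace_continuousP => x Ax.
apply: (@cvg_comp _ _ _ f g _ (within B (nbhs (f x)))); last first.
  exact: cg (AB _ Ax).
move=> U gU.
have fU : \forall y \near x, A y -> B (f y) -> U (f y) := cf x Ax _ gU.
have AU : \forall y \near x, A y -> U (f y).
  by apply: filterS fU => y fy Ay; exact: fy Ay (AB _ Ay).
exact: AU.
Qed.

Lemma within_continuousM A f g :
  {within A, continuous f} -> {within A, continuous g} ->
  {within A, continuous (fun x => f x * g x)}.
Proof. by move=> cf cg x; exact: continuousM (cf x) (cg x). Qed.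

Lemma within_continuous_cst A (u : R) : {within A, continuous (fun=> u)}.
Proof. exact/continuous_subspaceT/cst_continuous. Qed.

Lemma eq_within_continuous A f g : {in A, f =1 g} ->
  {within A, continuous f} -> {within A, continuous g}.
Proof. by move=> fg; exact: subspace_eq_continuous. Qed.

Lemma powR_within_continuous (r : R) : 0 <= r ->
  {within `[0, +oo[, continuous (@powR R ^~ r)}.
Proof.
rewrite le_eqVlt => /predU1P[<-|r0].
  (* The zeroth power is 1 at the base 0 as well, whereas a positive power vanishes there. *)
  have -> : (@powR R)^~ 0 = cst 1 by apply/funext => x; rewrite powRr0.
  exact/continuous_subspaceT/cst_continuous.
apply/continuous_within_itvcyP; split.
  move=> x x0; apply/differentiable_continuous/derivable1_diffP.
  by apply: derivable_powR; rewrite inE/=.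
by rewrite powR0 ?gt_eqF//; exact: powR_cvg0.
Qed.

Lemma within_continuous_powR A f (r : R) : 0 <= r ->
  (forall x, A x -> 0 <= f x) -> {within A, continuous f} ->
  {within A, continuous (fun x => f x `^ r)}.
Proof.
move=> r0 f0 cf.
have fA : {homo f : x / A x >-> [set` `[0, +oo[] x}.
  by move=> x Ax; rewrite /= in_itv/= andbT f0.
exact: within_continuous_comp_in fA cf (powR_within_continuous r0).
Qed.

Lemma onem_within_continuous A : {within A, continuous (fun t => 1 - t)}.
Proof.
apply: continuous_subspaceT => t.
by apply: cvgB; [exact: cvg_cst|exact: cvg_id].
Qed.

Lemma powR01_within_continuous (r : R) : 0 <= r ->
  {within `[0, 1], continuous (@powR R ^~ r)}.
Proof.
move=> r0; apply: continuous_subspaceW (powR_within_continuous r0).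
exact: subset_itvl.
Qed.

Lemma onem_powR01_within_continuous (r : R) : 0 <= r ->
  {within `[0, 1], continuous (fun t : R => (1 - t) `^ r)}.
Proof.
move=> r0; apply: within_continuous_powR => // [t|].
  by rewrite /= in_itv/= subr_ge0 => /andP[].
exact: onem_within_continuous.
Qed.

Lemma within_continuous_integrable (a b : R) f :
  {within `[a, b], continuous f} ->
  (@lebesgue_measure R).-integrable `[a, b] (EFin \o f).
Proof.
move=> cf; apply: continuous_compact_integrable => //.
exact: segment_compact.
Qed.

End within_continuity.

(** * Primitives and a mean value inequality *)

Section calculus.
Context {R : realType}.
Implicit Types (f g : R -> R).
Local Notation mu := (@lebesgue_measure R).

Lemma is_derive_Rintegral (a b : R) f : {within `[a, b], continuous f} ->
  forall x, x \in `]a, b[ ->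
  is_derive x 1 (fun y => \int[mu]_(t in `[a, y]) f t) (f x).
Proof.
move=> cf x xab.
have [ax xb] : a < x /\ x < b by rewrite !(itvP xab).
have ab := lt_trans ax xb.
have [d d'] := continuous_FTC1_closed xb (within_continuous_integrable cf) ax
  (within_continuous_continuous ab cf xab).
by rewrite -d' derive1E; exact: derivableP.
Qed.

(** Both [G + P] and [G - P] have nonnegative derivatives, so the mean value theorem makes both
    increments nonnegative. This stands in for integrating [dP], which may be discontinuous. *)
Lemma normr_derive_le (P dP G dG : R -> R) (a b : R) : a <= b ->
  {within `[a, b], continuous P} -> {within `[a, b], continuous G} ->
  (forall x, x \in `]a, b[ -> is_derive x 1 P (dP x)) ->
  (forall x, x \in `]a, b[ -> is_derive x 1 G (dG x)) ->
  (forall x, x \in `]a, b[ -> `|dP x| <= dG x) ->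
  `|P b - P a| <= G b - G a.
Proof.
rewrite le_eqVlt => /predU1P[<- *|ab cP cG dPE dGE le_dP].
  by rewrite !subrr normr0.
rewrite ler_norml; apply/andP; split.
- have [||c cab e] := MVT (f := P + G) (df := fun x => dP x + dG x) ab.
  + by move=> x /[dup] /dPE ? /dGE ?; exact: is_deriveD.
  + exact: within_continuousD.
  have := le_dP _ cab; rewrite ler_norml => /andP[h _].
  have : 0 <= (dP c + dG c) * (b - a) by rewrite mulr_ge0//; lra.
  rewrite -e /= !fctE; lra.
- have [||c cab e] := MVT (f := G - P) (df := fun x => dG x - dP x) ab.
  + by move=> x /[dup] /dPE ? /dGE ?; exact: is_deriveB.
  + exact: within_continuousB.
  have := le_dP _ cab; rewrite ler_norml => /andP[_ h].
  have : 0 <= (dG c - dP c) * (b - a) by rewrite mulr_ge0//; lra.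
  rewrite -e /= !fctE; lra.
Qed.

Lemma Rintegral_is_derive f (F : R -> R) (a b : R) : a < b ->
  {within `[a, b], continuous f} -> {within `[a, b], continuous F} ->
  (forall x, x \in `]a, b[ -> is_derive x 1 F (f x)) ->
  \int[mu]_(t in `[a, b]) f t = F b - F a.
Proof.
move=> ab cf /(continuous_within_itvP _ ab)[_ Fa Fb] dF.
rewrite /Rintegral (continuous_FTC2 (F := F))//.
- split => // x /dF dFx; exact: (@ex_derive _ _ _ _ _ _ _ dFx).
- by move=> x /dF ?; rewrite derive1E derive_val.
Qed.

Lemma Rintegral_powR (r : R) : 0 <= r ->
  \int[mu]_(t in `[0, 1]) (t `^ r) = (r + 1)^-1.
Proof.
move=> r0; have r1 : 0 < r + 1 by rewrite ltr_wpDl.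
transitivity ((r + 1)^-1 * 1 `^ (r + 1) - (r + 1)^-1 * 0 `^ (r + 1));
  last first.
  by rewrite powR1 powR0 ?gt_eqF// mulr0 subr0 mulr1.
apply: (Rintegral_is_derive (F := fun t => (r + 1)^-1 * t `^ (r + 1))) => //.
- exact: powR01_within_continuous.
- apply: within_continuousM; first exact: within_continuous_cst.
  exact: powR01_within_continuous (ltW r1).
- move=> x; rewrite in_itv/= => /andP[x0 _].
  have dpow := is_derive1_powR (r + 1) x0.
  have : is_derive x 1 ((r + 1)^-1 \*: (@powR R ^~ (r + 1)))
      ((r + 1)^-1 *: ((r + 1) * x `^ (r + 1 - 1))) by exact: is_deriveZ.
  by rewrite /GRing.scale/= mulKf ?gt_eqF// addrK.
Qed.

End calculus.

(** * Hoelder's inequality for real-valued integrals over a set *)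

Lemma Rintegral_hoelder d (T : measurableType d) (R : realType)
    (mu : {measure set T -> \bar R}) (D : set T) (f g : T -> R) (p q : R) :
  measurable D -> measurable_fun D f -> measurable_fun D g ->
  (forall x, D x -> 0 <= f x) -> (forall x, D x -> 0 <= g x) ->
  0 < p -> 0 < q -> p^-1 + q^-1 = 1 ->
  mu.-integrable D (fun x => (f x `^ p)%:E) ->
  mu.-integrable D (fun x => (g x `^ q)%:E) ->
  \int[mu]_(x in D) (f x * g x) <=
  (\int[mu]_(x in D) (f x `^ p)) `^ p^-1 *
  (\int[mu]_(x in D) (g x `^ q)) `^ q^-1.
Proof.
move=> mD mf mg f0 g0 p0 q0 pq ifp igq.
(* Extension by zero leaves the norm unchanged, because 0 to a positive power is 0. *)
have LnormE (h : T -> R) (r : R) : 0 < r -> (forall x, D x -> 0 <= h x) ->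
    mu.-integrable D (fun x => (h x `^ r)%:E) ->
    Lnorm mu r%:E (EFin \o (h \_ D)) =
    ((\int[mu]_(x in D) (h x `^ r)) `^ r^-1)%:E.
  move=> r0 h0 ih; rewrite -poweR_EFin /Rintegral fineK; last first.
    exact: integrable_fin_num.
  rewrite unlock; congr (_ `^ _)%E; rewrite [RHS]integral_mkcond.
  apply: eq_integral => x _; rewrite /= !patchE; case: ifPn => [|_].
    by rewrite inE => /h0 hx; rewrite ger0_norm.
  by rewrite normr0 powR0// gt_eqF.
have mfD : measurable_fun setT (f \_ D) by exact/(measurable_restrictT _ mD).
have mgD : measurable_fun setT (g \_ D) by exact/(measurable_restrictT _ mD).
have := hoelder mu mfD mgD p0 q0 pq.
rewrite !LnormE// -EFinM Lnorm1 => h.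
have fgE : (\int[mu]_x `|(EFin \o (f \_ D \* g \_ D)%R) x| =
    \int[mu]_(x in D) (f x * g x)%:E)%E.
  rewrite [RHS]integral_mkcond; apply: eq_integral => x _ /=.
  rewrite !patchE; case: ifPn => [|_]; last by rewrite mulr0 normr0.
  by rewrite inE => Dx; rewrite ger0_norm// mulr_ge0 ?f0 ?g0.
(* The integral of the product is finite because [h] bounds it by a product of two reals. *)
rewrite fgE in h; rewrite -lee_fin /Rintegral fineK// ge0_fin_numE.
  by apply: le_lt_trans h _; rewrite ltry.
by apply: integral_ge0 => x Dx; rewrite lee_fin mulr_ge0 ?f0 ?g0.
Qed.

(** * Derivatives relative to an interval *)

Section derive_within_interval.
Context {R : realType}.
Implicit Types (I : set R) (f : R -> R).

(** The substitution [y - x] for the increment carries punctured neighborhoods of [x] to those of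
    0. *)
Lemma slope_cvg_derive f (x : R) : derivable f x 1 ->
  Defs.slope f x y @[y --> x^'] --> 'D_1 f x.
Proof.
move=> df; have sub0 : y - x @[y --> x^'] --> 0^'.
  move=> A; rewrite /dnbhs /within/= => /nbhs_ballP[e /= e0 eA].
  apply/nbhs_ballP; exists e => //= y xy yx; apply: eA.
    by move: xy; rewrite -!ball_normE /ball_/= sub0r opprB.
  by rewrite subr_eq0.
have := cvg_comp _ _ sub0 df.
apply: cvg_trans; apply: near_eq_cvg; near=> y.
by rewrite /= /Defs.slope [_%:A]mulr1 subrK mulrC.
Unshelve. all: by end_near. Qed.

(** Near an interior point, restricting the punctured filter to [I] does not change it. *)
Lemma derive_within_interior I f (x : R) : I° x -> derivable f x 1 ->
  is_derive x 1 f (derive_within I f x).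
Proof.
move=> Ix df; have IxE : within I x^' = x^'.
  apply/seteqP; split => U xU.
    have xIU : \forall y \near x, y != x -> I y -> U y := xU.
    suff : \forall y \near x, y != x -> U y by [].
    by near=> y => yx; apply: (near xIU y) => //; near: y; exact: Ix.
  have xU' : \forall y \near x, y != x -> U y := xU.
  suff : \forall y \near x, y != x -> I y -> U y by [].
  by near=> y => yx _; exact: (near xU' y).
split=> //; rewrite /derive_within IxE; apply/esym/cvg_lim => //.
exact: slope_cvg_derive.
Unshelve. all: by end_near. Qed.

(** The increment of [f] is [y - x] times the slope, hence tends to [0 * l]. The point [y = x],
    absent from the punctured limit, is treated apart. *)
Lemma derivable_within_continuous_at I f (x : R) : derivable_within I f x ->
  f y @[y --> within I (nbhs x)] --> f x.
Proof.
move=> /cvg_ex[/= l sl]; apply/cvgrPdist_lt => e e0.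
have /cvgrPdist_lt/(_ _ e0) :
    (y - x) * Defs.slope f x y @[y --> within I x^'] --> 0 * l.
  apply: cvgM sl; rewrite -(subrr x); apply: cvgB; last exact: cvg_cst.
  by apply: cvg_within_filter; apply: cvg_within_filter; exact: cvg_id.
rewrite mul0r => near_e.
have near_slope : \forall y \near x, y != x -> I y ->
  `|0 - (y - x) * Defs.slope f x y| < e := near_e.
suff : \forall y \near x, I y -> `|f x - f y| < e by [].
near=> y => Iy; have [->|yx] := eqVneq y x; first by rewrite subrr normr0.
have : `|0 - (y - x) * Defs.slope f x y| < e by exact: (near near_slope y).
by rewrite sub0r normrN /Defs.slope mulrC divfK ?subr_eq0// distrC.
Unshelve. all: by end_near. Qed.

End derive_within_interval.

(** * The harmonic segment from [c] to [x] and its kernel *)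

Section harmonic_path.
Context {R : realType}.
Implicit Types c x t : R.

(** The weighted harmonic mean with weight [t] on [x]: the point at which [harmonically_convex],
    taken at [c] and [x], bounds a function. *)
Definition hpath c x t : R := c * x / (t * c + (1 - t) * x).

(** The factor [(x - c) ^+ 2] of [P'] is kept out of the kernel, so that it stays outside the p-th
    root in the final bound. *)
Definition hkernel c x t : R := t / (t * c + (1 - t) * x) ^+ 2.

Lemma hpath0 c x : x != 0 -> hpath c x 0 = c.
Proof. by move=> x0; rewrite /hpath mul0r add0r subr0 mul1r mulfK. Qed.

Lemma hpath1 c x : c != 0 -> hpath c x 1 = x.
Proof.
by move=> c0; rewrite /hpath subrr mul0r addr0 mul1r mulrAC mulfV// mul1r.
Qed.

Lemma convex_comb_gt0 c x t : 0 < c -> 0 < x -> 0 <= t <= 1 ->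
  0 < t * c + (1 - t) * x.
Proof. by move=> ? ? /andP[]; nra. Qed.

Lemma is_derive_hpath c x t : 0 < c -> 0 < x -> 0 <= t <= 1 ->
  is_derive t 1 (hpath c x) (c * x * (x - c) / (t * c + (1 - t) * x) ^+ 2).
Proof.
move=> c0 x0 t01; have A0 := convex_comb_gt0 c0 x0 t01.
pose A u : R := u * c + (1 - u) * x.
have dA : is_derive t 1 A (c - x).
  have -> : A = id * cst c + (cst 1 - id) * cst x by [].
  apply: is_derive_eq; rewrite /= !scaler0 !add0r /GRing.scale/=; ring.
have dh : is_derive t 1 (hpath c x) ((c * x) *: (- A t ^- 2 *: (c - x))).
  have -> : hpath c x = (c * x) \*: (fun u => (A u)^-1) by apply/funext => u.
  by apply: is_deriveZ; apply: is_deriveV; rewrite gt_eqF.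
apply: is_derive_eq; rewrite /GRing.scale/= /A; field.
by rewrite gt_eqF.
Qed.

Lemma hpath_within_continuous c x : 0 < c -> 0 < x ->
  {within `[0, 1], continuous (hpath c x)}.
Proof.
move=> c0 x0; apply: derivable_within_continuous => t t01.
by rewrite in_itv/= in t01; have [] := is_derive_hpath c0 x0 t01.
Qed.

Lemma hkernel_ge0 c x t : 0 <= t -> 0 <= hkernel c x t.
Proof. by move=> t0; rewrite divr_ge0// sqr_ge0. Qed.

(** The kernel is [t] times the square of [hpath c x t / (c * x)], so it inherits continuity from
    the path. *)
Lemma hkernel_within_continuous c x : 0 < c -> 0 < x ->
  {within `[0, 1], continuous (hkernel c x)}.
Proof.
move=> c0 x0.
apply: (@eq_within_continuous _ _
  (fun t => (c * x) ^- 2 * (t * (hpath c x t * hpath c x t)))).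
  move=> t; rewrite inE /= in_itv => t01; rewrite /hkernel /hpath.
  have A0 := convex_comb_gt0 c0 x0 t01; field.
  by rewrite !gt_eqF.
apply: within_continuousM; first exact: within_continuous_cst.
apply: within_continuousM.
  by apply: continuous_subspaceT => ?; exact: cvg_id.
by apply: within_continuousM; exact: hpath_within_continuous.
Qed.

Lemma hkernel_powR_within_continuous (c x p : R) : 0 < c -> 0 < x -> 0 <= p ->
  {within `[0, 1], continuous (fun t => hkernel c x t `^ p)}.
Proof.
move=> c0 x0 p0; have cK := hkernel_within_continuous c0 x0.
have K0 t : [set` `[0, 1]] t -> 0 <= hkernel c x t.
  by rewrite /= in_itv/= => /andP[/hkernel_ge0].
exact: within_continuous_powR p0 K0 cK.
Qed.

Lemma hkernel_powR (c x t p : R) : 0 < c -> 0 < x -> 0 <= t <= 1 ->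
  hkernel c x t `^ p = t `^ p * (t * c + (1 - t) * x) `^ (- (2 * p)).
Proof.
move=> c0 x0 t01; have A0 := ltW (convex_comb_gt0 c0 x0 t01).
rewrite /hkernel powRM; [|by case/andP: t01|by rewrite invr_ge0 sqr_ge0].
by rewrite -powR_invn// -powRrM mulNr.
Qed.

(** Clearing the denominator turns each bound into a sum with positive weights [t * c] and
    [(1 - t) * x] of two nonnegative distances, one of them positive since [c != x]. Strictness
    matters: [f] has a two-sided derivative only on the open interval. *)
Lemma hpath_itvoo (a b c x t : R) : 0 < a -> c \in `[a, b] -> x \in `[a, b] ->
  c != x -> t \in `]0, 1[ -> hpath c x t \in `]a, b[.
Proof.
rewrite !in_itv/= => a0 /andP[ac cb] /andP[ax xb] cx /andP[t0 t1].
have c0 := lt_le_trans a0 ac; have x0 := lt_le_trans a0 ax.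
have t01 : 0 <= t <= 1 by rewrite !ltW.
rewrite ltr_pdivlMr ?ltr_pdivrMr ?convex_comb_gt0//.
have tc0 : 0 < t * c by rewrite mulr_gt0.
have tx0 : 0 < (1 - t) * x by rewrite mulr_gt0 ?subr_gt0.
rewrite -subr_gt0 -[X in _ && X]subr_gt0.
rewrite (_ : c * x - _ = t * c * (x - a) + (1 - t) * x * (c - a)); last by ring.
rewrite (_ : _ - c * x = t * c * (b - x) + (1 - t) * x * (b - c)); last by ring.
have [xc|xc] : c < x \/ x < c by apply/orP; rewrite -neq_lt.
- by apply/andP; split; [apply: ltr_pwDl|apply: ltr_wpDl];
    (apply: mulr_gt0 || apply: mulr_ge0); lra.
- by apply/andP; split; [apply: ltr_wpDl|apply: ltr_pwDl];
    (apply: mulr_gt0 || apply: mulr_ge0); lra.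
Qed.

End harmonic_path.

(** * The estimate from one endpoint *)

Section harmonic_ostrowski.
Context {R : realType}.
Implicit Types (c x t : R).
Local Notation mu := (@lebesgue_measure R).

(** The points [c] and [x] come in either order, so the same estimate serves [c = a] and [c = b];
    the path runs leftwards when [x < c]. *)
Lemma Rintegral_hkernel_majorant (a b c x : R) (f df M : R -> R) :
  0 < a -> {within `[a, b], continuous f} ->
  (forall u, u \in `]a, b[ -> is_derive u 1 f (df u)) ->
  {within `[0, 1], continuous M} ->
  (forall t, t \in `]0, 1[ -> `|df (hpath c x t)| <= M t) ->
  c \in `[a, b] -> x \in `[a, b] -> c != x ->
  let F y := \int[mu]_(u in `[a, y]) (f u / u ^+ 2) in
  `|(c^-1 - x^-1) * f x - (F x - F c)| <=
  (x - c) ^+ 2 * \int[mu]_(t in `[0, 1]) (hkernel c x t * M t).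
Proof.
move=> a0 cf df_f cM leM cab xab cx.
set F := fun y => \int[mu]_(u in `[a, y]) (f u / u ^+ 2); cbv zeta.
have c0 : 0 < c by rewrite (lt_le_trans a0)// (itvP cab).
have x0 : 0 < x by rewrite (lt_le_trans a0)// (itvP xab).
have cff : {within `[a, b], continuous (fun u => f u / u ^+ 2)}.
  apply: within_continuousM => //; apply: continuous_in_subspaceT => u.
  rewrite inE/= => uab; apply: (@continuousV R R (fun v => v ^+ 2)); last first.
    exact: exprn_continuous.
  by rewrite expf_neq0// gt_eqF// (lt_le_trans a0)// (itvP uab).
have cF : {within `[a, b], continuous F}.
  apply: parameterized_integral_continuous (within_continuous_integrable cff).
  by rewrite (le_trans (_ : a <= c) (_ : c <= b))// (itvP cab).
have ch := hpath_within_continuous c0 x0.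
have hcc : {homo hpath c x : t / [set` `[0, 1]] t >-> [set` `[a, b]] t}.
  move=> t /=; rewrite in_itv/= => /andP[].
  rewrite le_eqVlt => /predU1P[<- _|t0].
    by rewrite hpath0 ?gt_eqF.
  rewrite le_eqVlt => /predU1P[->|t1].
    by rewrite hpath1 ?gt_eqF.
  apply: subset_itv_oo_cc; apply: hpath_itvoo => //.
  by rewrite in_itv/= t0.
have cK := within_continuousM (hkernel_within_continuous c0 x0) cM.
(* Since [1/u] is affine in [t], the factor [1/c - 1/u(t)] is [t * (x - c) / (c * x)]. The primitive
   [G] of the majorant is compared with [P]. *)
pose P t := (x - c) / (c * x) * (t * f (hpath c x t)) - F (hpath c x t).
pose G t := (x - c) ^+ 2 * \int[mu]_(u in `[0, t]) (hkernel c x u * M u).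
pose dh t := c * x * (x - c) / (t * c + (1 - t) * x) ^+ 2.
pose dP t := (x - c) / (c * x) *
   (f (hpath c x t) + t * (df (hpath c x t) * dh t))
  - f (hpath c x t) / hpath c x t ^+ 2 * dh t.
have -> : (c^-1 - x^-1) * f x - (F x - F c) = P 1 - P 0.
  rewrite /P hpath0 ?hpath1 ?gt_eqF//; field.
  by rewrite !gt_eqF.
have -> : (x - c) ^+ 2 * \int[mu]_(t in `[0, 1]) (hkernel c x t * M t) =
    G 1 - G 0.
  by rewrite /G set_itv1 Rintegral_set1 mulr0 subr0.
have dF := is_derive_Rintegral cff.
pose dG t := (x - c) ^+ 2 * (hkernel c x t * M t).
have cP : {within `[0, 1], continuous P}.
  apply: within_continuousB; last exact: within_continuous_comp_in hcc ch cF.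
  apply: within_continuousM; first exact: within_continuous_cst.
  apply: within_continuousM; last exact: within_continuous_comp_in hcc ch cf.
  by apply: continuous_subspaceT => ?; exact: cvg_id.
have cG : {within `[0, 1], continuous G}.
  apply: within_continuousM; first exact: within_continuous_cst.
  exact: parameterized_integral_continuous (within_continuous_integrable cK).
have dP_P t : t \in `]0, 1[ -> is_derive t 1 P (dP t).
  move=> t01; have htab := hpath_itvoo a0 cab xab cx t01.
  have dht : is_derive t 1 (hpath c x) (dh t).
    by apply: is_derive_hpath => //; rewrite !(itvP t01).
  have dfh := is_derive1_comp (df_f _ htab) dht.
  have dFh := is_derive1_comp (dF _ htab) dht.
  have -> : P = ((x - c) / (c * x)) \*: (id * (f \o hpath c x)) -
      (F \o hpath c x).
    by [].
  by apply: is_derive_eq; rewrite /dP /GRing.scale/= mulr1 [X in _ * X]addrC.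
have dG_G t : t \in `]0, 1[ -> is_derive t 1 G (dG t).
  by move=> t01; apply: is_deriveZ; exact: is_derive_Rintegral.
have dP_dG t : t \in `]0, 1[ -> `|dP t| <= dG t.
  move=> t01; have A0 : 0 < t * c + (1 - t) * x.
    by apply: convex_comb_gt0 => //; rewrite !(itvP t01).
  (* The two terms in [f] cancel because [dh t / hpath c x t ^+ 2 = (x - c) / (c * x)]; only the
     [df] term survives. *)
  have -> : dP t = (x - c) ^+ 2 * (hkernel c x t * df (hpath c x t)).
    rewrite /dP /dh /hkernel; move: (f _) (df _) => fh dfh.
    rewrite /hpath; field.
    by rewrite !gt_eqF.
  rewrite normrM ger0_norm ?sqr_ge0// ler_wpM2l ?sqr_ge0// normrM.
  have K0 : 0 <= hkernel c x t by rewrite hkernel_ge0// (itvP t01).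
  by rewrite ger0_norm// ler_wpM2l// leM.
exact: normr_derive_le ler01 cP cG dP_P dG_G dP_dG.
Qed.

Lemma Rintegral_onem (g : R -> R) : {within `[0, 1], continuous g} ->
  \int[mu]_(t in `[0, 1]) g (1 - t) = \int[mu]_(t in `[0, 1]) g t.
Proof.
move=> cg; rewrite [RHS]Rintegration_by_substitution_onem ?ler01 ?lexx//.
by rewrite /unstable.onem subrr.
Qed.

Lemma Rintegral_powR_mix (s u v : R) : 0 < s ->
  \int[mu]_(t in `[0, 1]) (t `^ s * u + (1 - t) `^ s * v) = (u + v) / (s + 1).
Proof.
move=> /ltW s0; have c1 := powR01_within_continuous s0.
have c2 := onem_powR01_within_continuous s0.
have cc (w : R) := @within_continuous_cst R `[0, 1] w.
rewrite RintegralD//; last 2 first.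
- by apply: within_continuous_integrable; exact: within_continuousM.
- by apply: within_continuous_integrable; exact: within_continuousM.
rewrite !RintegralZr//; last 2 first.
- exact: within_continuous_integrable.
- exact: within_continuous_integrable.
by rewrite (Rintegral_onem c1) Rintegral_powR// -mulrDr mulrC.
Qed.

Lemma harmonic_ostrowski_endpoint (a b c x s p q : R) (f df : R -> R) :
  0 < a -> {within `[a, b], continuous f} ->
  (forall u, u \in `]a, b[ -> is_derive u 1 f (df u)) ->
  0 < s -> 0 < p -> 0 < q -> p^-1 + q^-1 = 1 ->
  harmonically_convex s `[a, b] (fun u => `|df u| `^ q) ->
  c \in `[a, b] -> x \in `[a, b] ->
  let F y := \int[mu]_(u in `[a, y]) (f u / u ^+ 2) in
  `|(c^-1 - x^-1) * f x - (F x - F c)| <=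
  (\int[mu]_(t in `[0, 1]) (hkernel c x t `^ p)) `^ p^-1 * (x - c) ^+ 2 *
  ((`|df x| `^ q + `|df c| `^ q) / (s + 1)) `^ q^-1.
Proof.
move=> a0 cf df_f s0 p0 q0 pq hdf cab xab.
set F := fun y => \int[mu]_(u in `[a, y]) (f u / u ^+ 2); cbv zeta.
(* For [c = x] the path is constant and both sides vanish. *)
have [<-|cx] := eqVneq c x.
  by rewrite !subrr mul0r subr0 normr0 expr0n/= mulr0 mul0r.
have c0 : 0 < c by rewrite (lt_le_trans a0)// (itvP cab).
have x0 : 0 < x by rewrite (lt_le_trans a0)// (itvP xab).
pose N t := t `^ s * `|df x| `^ q + (1 - t) `^ s * `|df c| `^ q.
have N0 t : 0 <= N t by rewrite addr_ge0// mulr_ge0// powR_ge0.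
have cN : {within `[0, 1], continuous N}.
  have cc (w : R) := @within_continuous_cst R `[0, 1] w.
  apply: within_continuousD; apply: within_continuousM => //.
    exact: powR01_within_continuous (ltW s0).
  exact: onem_powR01_within_continuous (ltW s0).
have q'0 : 0 <= q^-1 by rewrite invr_ge0 ltW.
have cM : {within `[0, 1], continuous (fun t => N t `^ q^-1)}.
  exact: within_continuous_powR.
have NK t : (N t `^ q^-1) `^ q = N t.
  by rewrite -powRrM mulVf ?gt_eqF// powRr1.
have leM t : t \in `]0, 1[ -> `|df (hpath c x t)| <= N t `^ q^-1.
  move=> t01; rewrite -[leLHS]powRr1//.
  rewrite -[X in _ `^ X <= _](@mulfV _ q) ?gt_eqF//.
  rewrite powRrM ge0_ler_powR ?nnegrE ?powR_ge0//.
  by apply: hdf => //; rewrite !(itvP t01).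
have cK := hkernel_within_continuous c0 x0.
have K0 t : [set` `[0, 1]] t -> 0 <= hkernel c x t.
  by rewrite /= in_itv/= => /andP[/hkernel_ge0].
have M0 t : [set` `[0, 1]] t -> 0 <= N t `^ q^-1 by move=> _; exact: powR_ge0.
apply: le_trans (Rintegral_hkernel_majorant a0 cf df_f cM leM cab xab cx) _.
rewrite [leRHS]mulrAC [leRHS]mulrC ler_wpM2l ?sqr_ge0//.
have <- : \int[mu]_(t in `[0, 1]) ((N t `^ q^-1) `^ q) =
    (`|df x| `^ q + `|df c| `^ q) / (s + 1).
  by rewrite -Rintegral_powR_mix//; apply: eq_Rintegral => t _; exact: NK.
apply: Rintegral_hoelder => //.
- exact: measurable_realfun.subspace_continuous_measurable_fun.
- exact: measurable_realfun.subspace_continuous_measurable_fun.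
- apply: (within_continuous_integrable (f := fun t => hkernel c x t `^ p)).
  exact: hkernel_powR_within_continuous c0 x0 (ltW p0).
- apply: (within_continuous_integrable (f := fun t => (N t `^ q^-1) `^ q)).
  exact: within_continuous_powR (ltW q0) M0 cM.
Qed.

(** * The lambda functions as integrals of kernel powers *)

Lemma euler_beta_r1 (r : R) : 1 <= r -> euler_beta r 1 = r^-1.
Proof.
move=> r1; rewrite /euler_beta -[in RHS](subrK 1 r) -Rintegral_powR ?subr_ge0//.
by apply: eq_Rintegral => t _; rewrite subrr powRr0 mulr1.
Qed.

Lemma euler_beta_1r (r : R) : 1 <= r -> euler_beta 1 r = r^-1.
Proof.
move=> r1; have r0 : 0 <= r - 1 by rewrite subr_ge0.
rewrite /euler_beta -[in RHS](subrK 1 r) -Rintegral_powR//.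
rewrite -(Rintegral_onem (powR01_within_continuous r0)).
by apply: eq_Rintegral => t _; rewrite subrr powRr0 mul1r.
Qed.

(** The Beta prefactor cancels the normalization of the hypergeometric integral, and pulling [x] out
    of [t * a + (1 - t) * x] leaves [1 - z * t] with [z = 1 - a / x]. *)
Lemma lambda1E (a x p : R) : 0 < a -> 0 < x -> 0 < p ->
  lambda1 a x 0 p p = \int[mu]_(t in `[0, 1]) (hkernel a x t `^ p).
Proof.
move=> a0 x0 p0; rewrite /lambda1 /hypergeom21 addr0.
have -> : p + 2 - (p + 1) = 1 by ring.
have p1 : 1 <= p + 1 by rewrite lerDr ltW.
have beta0 : euler_beta (p + 1) 1 != 0.
  by rewrite euler_beta_r1// invr_neq0// gt_eqF// addr_gt0.
rewrite mulrA [_ / _ / _]mulrAC mulfV// mul1r.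
have base t : t * a + (1 - t) * x = x * (1 - (1 - a / x) * t).
  by field; rewrite gt_eqF.
transitivity ((x `^ (2 * p))^-1 *
    \int[mu]_(t in `[0, 1]) (x `^ (2 * p) * hkernel a x t `^ p)).
  congr (_ * _); apply: eq_Rintegral => t; rewrite inE/= in_itv/= => t01.
  have A0 := convex_comb_gt0 a0 x0 t01.
  rewrite hkernel_powR// addrK subrr powRr0 mulr1 mulrCA; congr (_ * _).
  rewrite base powRM ?(ltW x0)//; last by rewrite -(pmulr_rge0 _ x0) -base ltW.
  by rewrite mulrA [in RHS]powRN mulfV ?mul1r// gt_eqF// powR_gt0.
rewrite RintegralZl//; first by rewrite mulKf// gt_eqF// powR_gt0.
apply: within_continuous_integrable.
exact: hkernel_powR_within_continuous a0 x0 (ltW p0).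
Qed.

(** Here the Euler integrand carries [1 - t] to the power [p], so the kernel is first reflected by
    [t -> 1 - t]; then [b] is pulled out as [x] was for [lambda1]. *)
Lemma lambda3E (b x p : R) : 0 < b -> 0 < x -> 0 < p ->
  lambda3 b x 0 p p = \int[mu]_(t in `[0, 1]) (hkernel b x t `^ p).
Proof.
move=> b0 x0 p0; rewrite /lambda3 /hypergeom21 addr0.
have -> : p + 2 - 1 = p + 1 by ring.
have p1 : 1 <= p + 1 by rewrite lerDr ltW.
have beta0 : euler_beta 1 (p + 1) != 0.
  by rewrite euler_beta_1r// invr_neq0// gt_eqF// addr_gt0.
rewrite mulrA [_ / _ / _]mulrAC mulfV// mul1r.
have base t : (1 - t) * b + (1 - (1 - t)) * x = b * (1 - (1 - x / b) * t).
  by field; rewrite gt_eqF.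
have cK := hkernel_powR_within_continuous b0 x0 (ltW p0).
have onemK : {homo (fun t : R => 1 - t) :
    t / [set` `[0, 1]] t >-> [set` `[0, 1]] t}.
  by move=> t /=; rewrite !in_itv/=; lra.
have cK1 := within_continuous_comp_in onemK
  (@onem_within_continuous R `[0, 1]) cK.
rewrite -[RHS](Rintegral_onem cK).
transitivity ((b `^ (2 * p))^-1 *
    \int[mu]_(t in `[0, 1]) (b `^ (2 * p) * hkernel b x (1 - t) `^ p)).
  congr (_ * _); apply: eq_Rintegral => t; rewrite inE/= => /onemK/=.
  rewrite in_itv/= => t01; have A0 := convex_comb_gt0 b0 x0 t01.
  rewrite hkernel_powR// addrK subrr powRr0 mul1r mulrCA; congr (_ * _).
  rewrite base powRM ?(ltW b0)//; last by rewrite -(pmulr_rge0 _ b0) -base ltW.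
  by rewrite mulrA [in RHS]powRN mulfV ?mul1r// gt_eqF// powR_gt0.
rewrite RintegralZl//; first by rewrite mulKf// gt_eqF// powR_gt0.
exact: within_continuous_integrable cK1.
Qed.

End harmonic_ostrowski.

(** * Combination of the two endpoint estimates *)

Theorem theorem8 (R : realType) (s : R) (I : set R) (f : R -> R)
    (a b p q : R) :
  0 < s <= 1 ->
  is_interval I -> I `<=` `]0, +oo[ ->
  (forall x, I° x -> derivable f x 1) ->
  I a -> I b -> a < b ->
  (forall x, x \in `[a, b] -> derivable_within I f x) ->
  (@lebesgue_measure R).-integrable `[a, b] (EFin \o derive_within I f) ->
  1 < q -> p^-1 + q^-1 = 1 ->
  harmonically_convex s `[a, b] (fun x => `|derive_within I f x| `^ q) ->
  forall x, x \in `[a, b] ->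
  `|f x - a * b / (b - a) *
      \int[@lebesgue_measure R]_(u in `[a, b]) (f u / u ^+ 2)| <=
  a * b / (b - a) *
  ((lambda1 a x 0 p p) `^ p^-1 * (x - a) ^+ 2 *
     ((`|derive_within I f x| `^ q + `|derive_within I f a| `^ q) / (s + 1))
       `^ q^-1 +
   (lambda3 b x 0 p p) `^ p^-1 * (b - x) ^+ 2 *
     ((`|derive_within I f x| `^ q + `|derive_within I f b| `^ q) / (s + 1))
       `^ q^-1).
Proof.
move=> /andP[s0 _] itvI I0 dfI Ia Ib ab dfab _ q1 pq hdf x xab.
have a0 : 0 < a by have := I0 _ Ia; rewrite /= in_itv/= andbT.
have b0 : 0 < b := lt_trans a0 ab.
have x0 : 0 < x by rewrite (lt_le_trans a0)// (itvP xab).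
have q0 : 0 < q := lt_trans ltr01 q1.
have p0 : 0 < p.
  by rewrite -invr_gt0 -(addrK q^-1 p^-1) pq subr_gt0 invf_lt1.
have abI : `[a, b] `<=` I.
  by move=> u /=; rewrite in_itv/= => uab; exact: itvI Ia Ib _ uab.
have cf : {within `[a, b], continuous f}.
  apply/subspace_continuousP => u uab.
  have := derivable_within_continuous_at (dfab _ uab).
  apply: cvg_trans; apply: cvg_app; exact: within_subset.
have df u : u \in `]a, b[ -> is_derive u 1 f (derive_within I f u).
  move=> uab; have Iu : I° u.
    apply: (@filterS _ (nbhs u) _ `]a, b[) => [v /= vab|].
      by apply: abI; exact: subset_itv_oo_cc.
    exact: near_in_itvoo.
  exact: derive_within_interior Iu (dfI _ Iu).
have aab : a \in `[a, b] by rewrite in_itv/= lexx ltW.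
have bab : b \in `[a, b] by rewrite in_itv/= lexx ltW.
pose F y := \int[@lebesgue_measure R]_(u in `[a, y]) (f u / u ^+ 2).
have Ha : `|(a^-1 - x^-1) * f x - (F x - F a)| <= _ :=
  harmonic_ostrowski_endpoint a0 cf df s0 p0 q0 pq hdf aab xab.
have Hb : `|(b^-1 - x^-1) * f x - (F x - F b)| <= _ :=
  harmonic_ostrowski_endpoint a0 cf df s0 p0 q0 pq hdf bab xab.
have Fa : F a = 0 by rewrite /F set_itv1 Rintegral_set1.
rewrite Fa subr0 -lambda1E// in Ha.
rewrite -lambda3E// -[x - b]opprB sqrrN in Hb; rewrite -/(F b).
have ab0 : 0 < a * b / (b - a) by rewrite divr_gt0 ?mulr_gt0// subr_gt0.
(* In the difference, [f x / x] and [F x] cancel, leaving [(a^-1 - b^-1) * f x - F b]; the prefactor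
   is the inverse of [a^-1 - b^-1]. The triangle inequality then adds the two bounds. *)
have -> : f x - a * b / (b - a) * F b = a * b / (b - a) *
    (((a^-1 - x^-1) * f x - F x) - ((b^-1 - x^-1) * f x - (F x - F b))).
  by field; rewrite !gt_eqF// subr_gt0.
rewrite normrM gtr0_norm// ler_wpM2l ?(ltW ab0)//.
by apply: le_trans (ler_normB _ _) _; exact: lerD Ha Hb.
Qed.
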